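(* Let $G\in\mathcal M_{N,K}$ and suppose that $G$ contains no zero entries. Let $I,J,T\subseteq(0,\infty)$ be open intervals. Then $G$ is equidistributed if and only if $\nabla[\Phi_{diag}^\delta+\Phi_{ch}^{\alpha,\beta}](G)=0$ for all $\alpha\in I$, $\beta\in J$ and $\delta\in T$.
   Context: Let $\mathbb F=\mathbb R$ or $\mathbb C$ and let $1\le K\le N$ be integers. $\mathcal M_{N,K}=\{G\in\mathbb F^{N\times N}: G=G^2=G^*,\ \mathrm{tr}(G)=K\}$, regarded as a real analytic submanifold of the Hermitian (resp. symmetric) matrices with the Riemannian metric $X\cdot Y=\mathrm{tr}(XY)$; $\nabla$ is the corresponding Riemannian gradient on $\mathcal M_{N,K}$. Indices lie in $\mathbb Z_N$ (so $x+1$ is taken modulo $N$). Open intervals are nonempty. For $G=(G_{a,b})\in\mathcal M_{N,K}$ and $\alpha,\beta,\delta>0$: - diagonal potential: $\Phi_{diag}^\delta(G)=\frac1\delta\sum_{j=1}^N e^{\delta|G_{j,j}|^2}-\frac N\delta e^{\delta K^2/N^2}$; - exponential row sum potential: $R_x^{\alpha,\beta}(G)=\frac1\alpha\sum_{j\ne x}e^{\alpha|G_{x,j}|^2}+\beta e^{|G_{x,x}|^2}$ for $x\in\mathbb Z_N$; - chain potential: $\Phi_{ch}^{\alpha,\beta}(G)=\sum_{x\in\mathbb Z_N}\left(R_x^{\alpha,\beta}(G)-R_{x+1}^{\alpha,\beta}(G)\right)^2$. $G$ is equidistributed if for each pair $p,q\in\mathbb Z_N$ there exists a permutation $\pi$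 of $\mathbb Z_N$ with $|G_{j,p}|=|G_{\pi(j),q}|$ for all $j\in\mathbb Z_N$. *)

(* Defs.v *)
From HB Require Import structures.
From mathcomp Require Import all_boot all_order all_algebra all_fingroup.
From mathcomp Require Import all_classical all_reals all_analysis.
From mathcomp Require Import complex.

Set Implicit Arguments.
Unset Strict Implicit.
Unset Printing Implicit Defensive.
Import Order.TTheory GRing.Theory Num.Theory.
Import numFieldNormedType.Exports.
Local Open Scope ring_scope.
Local Open Scope classical_set_scope.

(* The two scalar fields.  Both are treated as subfields of R[i], so that a
   matrix over the real field is a complex matrix with real entries; on such
   matrices the adjoint is the transpose and the complex modulus is the
   absolute value. *)
Variant scalar_field := RealScalars | ComplexScalars.

Definition scalars (R : realType) (F : scalar_field) : {pred R[i]} :=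
  match F with
  | RealScalars => Num.real
  | ComplexScalars => predT
  end.

Definition adjoint (R : realType) (N : nat) (A : 'M[R[i]]_N) : 'M[R[i]]_N :=
  map_mx Num.conj A^T.

Definition projections (R : realType) (F : scalar_field) (N K : nat) :
    set 'M[R[i]]_N :=
  [set G | [/\ G \is a mxOver (scalars F),
               G = G *m G, G = adjoint G & \tr G = K%:R]].

(* The modulus as an element of R; `|z| has type R[i]. *)
Definition modulus (R : realType) (z : R[i]) : R := complex.Re `|z|.

(* Differential calculus of curves R -> 'M[R[i]]_N, where the complex matrices
   are seen as a real vector space: everything is done on the real and
   imaginary parts of the entries. *)
Definition C1_function (R : realType) (g : R -> R) : Prop :=
  (forall t, derivable g t 1) /\ continuous (derive1 g).

Definition C1_curve (R : realType) (N : nat) (c : R -> 'M[R[i]]_N) : Prop :=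
  forall i j, C1_function (fun t => complex.Re (c t i j)) /\
              C1_function (fun t => complex.Im (c t i j)).

Definition velocity (R : realType) (N : nat) (c : R -> 'M[R[i]]_N) (t : R) :
    'M[R[i]]_N :=
  \matrix_(i, j) Complex (derive1 (fun s => complex.Re (c s i j)) t)
                         (derive1 (fun s => complex.Im (c s i j)) t).

Definition curve_through (R : realType) (N : nat) (M : set 'M[R[i]]_N)
    (G : 'M[R[i]]_N) (c : R -> 'M[R[i]]_N) : Prop :=
  [/\ C1_curve c, forall t, M (c t) & c 0 = G].

Definition tangent_space (R : realType) (N : nat) (M : set 'M[R[i]]_N)
    (G : 'M[R[i]]_N) : set 'M[R[i]]_N :=
  [set V | exists2 c, curve_through M G c & V = velocity c 0].

(* tr(XY) is a real number when X and Y are Hermitian; the real part only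
   serves to land in R. *)
Definition trace_metric (R : realType) (N : nat) (X Y : 'M[R[i]]_N) : R :=
  complex.Re (\tr (X *m Y)).

(* V is the Riemannian gradient at G of the restriction of f to the
   submanifold M of the Hermitian matrices: it is the tangent vector
   representing the differential of f with respect to the trace metric. *)
Definition is_riemannian_gradient (R : realType) (N : nat)
    (M : set 'M[R[i]]_N) (f : 'M[R[i]]_N -> R) (G V : 'M[R[i]]_N) : Prop :=
  tangent_space M G V /\
  forall c, curve_through M G c ->
    is_derive (0 : R) (1 : R) (fun t => f (c t))
              (trace_metric V (velocity c 0)).

Definition diagonal_potential (R : realType) (N K : nat) (delta : R)
    (G : 'M[R[i]]_N) : R :=
  delta^-1 * (\sum_(j < N) expR (delta * modulus (G j j) ^+ 2))
  - N%:R / delta * expR (delta * (K%:R ^+ 2 / N%:R ^+ 2)).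

Definition row_sum_potential (R : realType) (N : nat) (alpha beta : R)
    (x : 'I_N) (G : 'M[R[i]]_N) : R :=
  alpha^-1 * (\sum_(j < N | j != x) expR (alpha * modulus (G x j) ^+ 2))
  + beta * expR (modulus (G x x) ^+ 2).

(* ordS is the successor modulo N. *)
Definition chain_potential (R : realType) (N : nat) (alpha beta : R)
    (G : 'M[R[i]]_N) : R :=
  \sum_(x < N) (row_sum_potential alpha beta x G
                - row_sum_potential alpha beta (ordS x) G) ^+ 2.

Definition equidistributed (R : realType) (N : nat) (G : 'M[R[i]]_N) : Prop :=
  forall p q : 'I_N, exists s : 'S_N,
    forall j : 'I_N, modulus (G j p) = modulus (G (s j) q).

Definition open_interval (R : realType) (I : set R) : Prop :=
  [/\ open I, is_interval I & I !=set0].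

(* Main.v *)
Require Import Defs.
From HB Require Import structures.
From mathcomp Require Import all_boot all_order all_algebra all_fingroup.
From mathcomp Require Import all_classical all_reals all_analysis.
From mathcomp Require Import complex.
From mathcomp Require Import ring.
Import Order.TTheory GRing.Theory Num.Theory.
Import numFieldNormedType.Exports.
Local Open Scope ring_scope.
Local Open Scope classical_set_scope.
Set Implicit Arguments.
Unset Strict Implicit.
Unset Printing Implicit Defensive.

(** The differential of the potential along a curve depends on the curve only
    through the derivatives of the squared moduli [|c_ij|^2].  Write [G'_ij]
    for these derivatives and [R_x] for the row sums at [G].

    If [G] is equidistributed, then [G_jj], the sum of the squared moduli of
    column [j], is the same for all [j], and so is [R_x] for all [x].  Every
    difference in the chain potential then vanishes at [G], and the square makes
    its differential vanish; the differential of the diagonal potential is a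
    multiple of the derivative of the trace, which is constant
    ([equidistributed_critical]).

    For the converse, one test curve for each pair [p != q] is enough: conjugate
    [G] by the plane rotations in coordinates [p] and [q], twisted by the phase
    of [G_pq].  At [G] it moves, to first order, no diagonal entry but [G_pp] and
    [G_qq], and moves those by [2 |G_pq|] and [- 2 |G_pq|]
    ([diagonal_moving_curve]); this speed is nonzero because [G] has no zero
    entry.  Along this curve:

    - As a function of [delta], the vanishing derivative is a combination of
      [exp (delta G_pp^2)], [exp (delta G_qq^2)] and a constant, with nonzero
      coefficients on the first two.  Exponentials with distinct exponents are
      linearly independent on an interval ([exp_sum_eq0]), so [G_pp = G_qq]
      ([critical_diag]).
    - Once the diagonal is constant, the differences [r_x = R_x - R_(x+1)] do not
      depend on [beta], and the derivative is affine in [beta] with slope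
      proportional to [\sum_x (r_x - r_(x-1)) G'_xx].  Hence
      [r_p - r_(p-1) = r_q - r_(q-1)].  A function on a cycle with constant
      increments is constant; this applies to [r], and then to [R]
      ([critical_row_sum]).
    - So [\sum_j exp (alpha |G_xj|^2)] does not depend on [x] for [alpha] in an
      interval, and linear independence of exponentials identifies the
      multisets of moduli of any two rows ([perm_of_exp_sum_eq]). *)

(** * Linear independence of exponentials *)

(** Sampling at finitely many points in arithmetic progression turns an identity
    between exponentials into one between powers. *)
Lemma open_interval_step {R : realType} {A : set R} : open_interval A ->
  forall n : nat, exists s h : R,
    0 < h /\ forall k : nat, (k <= n)%N -> A (s + k%:R * h).
Proof.
move=> [oA _ [s As]] n.
have [e /= e0 He] : exists2 e : R, 0 < e & ball s e `<=` A.
  by apply/nbhs_ballP; exact: open_nbhs_nbhs.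
exists s, (e / n.+1%:R); split; first by rewrite divr_gt0.
move=> k kn; apply: He; rewrite /ball /= opprD addrA subrr add0r normrN.
rewrite ger0_norm ?mulr_ge0 ?divr_ge0 ?ler0n ?ltW//.
by rewrite mulrCA gtr_pMr// ltr_pdivrMr// mul1r ltr_nat ltnS.
Qed.

(** At the points [s + k h] the hypothesis says that the weights
    [m j * expR (s * a j)] annihilate the powers [expR (h * a j) ^+ k], hence all
    polynomials of bounded degree in [expR (h * a j)].  The polynomial that
    vanishes at every node except the one of exponent [v] isolates the claim.
    The exponents may repeat, which is why only the total weight of each
    exponent is zero. *)
Lemma exp_sum_eq0 {R : realType} {A : set R} {J : finType} (m a : J -> R) :
  open_interval A ->
  (forall s, A s -> \sum_j m j * expR (s * a j) = 0) ->
  forall v, \sum_(j | a j == v) m j = 0.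
Proof.
move=> oA sum0 v.
have [s [h [h0 Ash]]] := open_interval_step oA #|J|.
pose rs := [seq expR (h * a j) | j <- enum J & a j != v].
pose p := \prod_(y <- rs) ('X - y%:P).
have size_p : (size p <= #|J|.+1)%N.
  rewrite size_prod_XsubC ltnS size_map size_filter.
  by rewrite (leq_trans (count_size _ _))// -cardE.
have p_eq0 j : a j != v -> p.[expR (h * a j)] = 0.
  move=> jv; apply/rootP; rewrite root_prod_XsubC.
  by apply: map_f; rewrite mem_filter jv mem_enum.
have p_neq0 : p.[expR (h * v)] != 0.
  rewrite -[_ == 0]/(root p _) root_prod_XsubC; apply/negP => /mapP[j].
  rewrite mem_filter => /andP[jv _] /expR_inj /(mulfI (lt0r_neq0 h0)) vj.
  by rewrite vj eqxx in jv.
have : \sum_j m j * expR (s * a j) * p.[expR (h * a j)] = 0.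
  under eq_bigr do rewrite (horner_coef_wide _ size_p) mulr_sumr.
  rewrite exchange_big big1//= => k _.
  have /sum0 sum_k : A (s + k%:R * h) by apply: Ash; rewrite -ltnS.
  transitivity (p`_k * \sum_j m j * expR ((s + k%:R * h) * a j)).
    rewrite mulr_sumr; apply: eq_bigr => j _.
    by rewrite -expRM_natl mulrDl expRD -(mulrA _ h); ring.
  by rewrite sum_k mulr0.
rewrite (bigID (fun j => a j == v)) /= [X in _ + X]big1 ?addr0; last first.
  by move=> j /p_eq0->; rewrite mulr0.
rewrite (eq_bigr (fun j => m j * expR (s * v) * p.[expR (h * v)])); last first.
  by move=> j /eqP->.
rewrite -!mulr_suml => /eqP; rewrite !mulf_eq0 (negPf p_neq0) orbF.
by rewrite (negPf (lt0r_neq0 (expR_gt0 _))) orbF => /eqP.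
Qed.

Lemma perm_of_exp_sum_eq {R : realType} {A : set R} {N : nat}
    (a b : 'I_N -> R) : open_interval A ->
  (forall s, A s -> \sum_j expR (s * a j) = \sum_j expR (s * b j)) ->
  exists p : 'S_N, forall j, a j = b (p j).
Proof.
move=> oA eqs.
suff /tuple_permP[p ep] : perm_eq [tuple a j | j < N] [tuple b j | j < N].
  exists p => j.
  have := congr1 (nth 0 ^~ j) ep.
  by rewrite !nth_mktuple tnth_mktuple.
(* The two families form one family of exponents, with weights 1 and -1. *)
pose m (u : 'I_N + 'I_N) : R := if u is inl _ then 1 else -1.
pose c (u : 'I_N + 'I_N) : R := match u with inl j => a j | inr j => b j end.
have cancel s : A s -> \sum_u m u * expR (s * c u) = 0.
  move=> As; rewrite big_sumType/= -[X in X + _]mulr_sumr mul1r.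
  by rewrite -[X in _ + X]mulr_sumr mulN1r eqs// subrr.
apply/allP => v _ /=.
have := exp_sum_eq0 oA cancel v.
rewrite big_sumType/= !sumr_const /= mulNrn => /eqP; rewrite subr_eq0 eqr_nat.
have cnt (f : 'I_N -> R) : count_mem v [seq f j | j <- enum 'I_N] = #|[pred j | f j == v]|.
  by rewrite count_map enumT cardE /enum_mem size_filter; apply: eq_count.
by rewrite !cnt.
Qed.

(** * Derivatives of curves of complex matrices *)

(** Carrying the derivative together with its continuity makes the relation
    stable under products, so that being of class C1 and the value of the
    velocity come out of one computation. *)
Definition C1_derivative {R : realType} (f f' : R -> R) : Prop :=
  (forall t : R, is_derive t (1 : R) f (f' t)) /\ continuous f'.

Lemma C1_derivative_continuous {R : realType} (f f' : R -> R) :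
  C1_derivative f f' -> continuous f.
Proof.
move=> [df _] t; apply: differentiable_continuous.
by apply/derivable1_diffP; have [] := df t.
Qed.

Lemma C1_derivative_cst {R : realType} (a : R) :
  C1_derivative (fun=> a) (fun=> 0).
Proof. by split=> t; [exact: is_derive_cst|exact: cvg_cst]. Qed.

Lemma C1_derivativeD {R : realType} (f f' g g' : R -> R) :
  C1_derivative f f' -> C1_derivative g g' ->
  C1_derivative (fun t => f t + g t) (fun t => f' t + g' t).
Proof.
move=> [df cf] [dg cg]; split=> t; first exact: is_deriveD.
by apply: cvgD; [exact: cf|exact: cg].
Qed.

Lemma C1_derivativeB {R : realType} (f f' g g' : R -> R) :
  C1_derivative f f' -> C1_derivative g g' ->
  C1_derivative (fun t => f t - g t) (fun t => f' t - g' t).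
Proof.
move=> [df cf] [dg cg]; split=> t; first exact: is_deriveB.
by apply: cvgB; [exact: cf|exact: cg].
Qed.

Lemma C1_derivativeM {R : realType} (f f' g g' : R -> R) :
  C1_derivative f f' -> C1_derivative g g' ->
  C1_derivative (fun t => f t * g t) (fun t => f' t * g t + f t * g' t).
Proof.
move=> Df Dg; have cf := C1_derivative_continuous Df.
have cg := C1_derivative_continuous Dg.
case: Df Dg => [df cf'] [dg cg']; split=> t.
  by apply: is_derive_eq (is_deriveM (df t) (dg t)) _; rewrite addrC /GRing.scale/= mulrC.
by apply: cvgD; apply: cvgM; [exact: cf'|exact: cg|exact: cf|exact: cg'].
Qed.

Lemma C1_derivative_cos {R : realType} :
  C1_derivative (@cos R) (fun t => - sin t).
Proof.
split=> t; first exact: is_derive_cos.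
by apply: cvgN; exact: continuous_sin.
Qed.

Lemma C1_derivative_sin {R : realType} : C1_derivative (@sin R) (@cos R).
Proof. by split=> t; [exact: is_derive_sin|exact: continuous_cos]. Qed.

Definition complex_C1_derivative {R : realType} (g g' : R -> R[i]) : Prop :=
  C1_derivative (fun t => complex.Re (g t)) (fun t => complex.Re (g' t)) /\
  C1_derivative (fun t => complex.Im (g t)) (fun t => complex.Im (g' t)).

Lemma complex_C1_derivative_cst {R : realType} (a : R[i]) :
  complex_C1_derivative (fun=> a) (fun=> 0).
Proof. by split; exact: C1_derivative_cst. Qed.

Lemma complex_C1_derivativeD {R : realType} (f f' g g' : R -> R[i]) :
  complex_C1_derivative f f' -> complex_C1_derivative g g' ->
  complex_C1_derivative (fun t => f t + g t) (fun t => f' t + g' t).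
Proof.
move=> [fr fi] [gr gi]; split; under eq_fun do rewrite raddfD/=;
  under [X in C1_derivative _ X]eq_fun do rewrite raddfD/=;
  exact: C1_derivativeD.
Qed.

Lemma complex_C1_derivativeM {R : realType} (f f' g g' : R -> R[i]) :
  complex_C1_derivative f f' -> complex_C1_derivative g g' ->
  complex_C1_derivative (fun t => f t * g t) (fun t => f' t * g t + f t * g' t).
Proof.
have ReM (z w : R[i]) : complex.Re (z * w) =
    complex.Re z * complex.Re w - complex.Im z * complex.Im w.
  by case: z; case: w.
have ImM (z w : R[i]) : complex.Im (z * w) =
    complex.Re z * complex.Im w + complex.Im z * complex.Re w.
  by case: z; case: w.
move=> [fr fi] [gr gi]; split.
  have := C1_derivativeB (C1_derivativeM fr gr) (C1_derivativeM fi gi).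
  congr C1_derivative; apply/funext => t; rewrite ?raddfD/= !ReM//; ring.
have := C1_derivativeD (C1_derivativeM fr gi) (C1_derivativeM fi gr).
congr C1_derivative; apply/funext => t; rewrite ?raddfD/= !ImM//; ring.
Qed.

Lemma complex_C1_derivative_sum {R : realType} (n : nat)
    (f f' : 'I_n -> R -> R[i]) :
  (forall i, complex_C1_derivative (f i) (f' i)) ->
  complex_C1_derivative (fun t => \sum_i f i t) (fun t => \sum_i f' i t).
Proof.
elim: n f f' => [|n IHn] f f' df.
  under eq_fun do rewrite big_ord0.
  under [X in complex_C1_derivative _ X]eq_fun do rewrite big_ord0.
  exact: complex_C1_derivative_cst.
under eq_fun do rewrite big_ord_recr.
under [X in complex_C1_derivative _ X]eq_fun do rewrite big_ord_recr.
by apply: complex_C1_derivativeD; [apply: IHn|].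
Qed.

Definition matrix_C1_derivative {R : realType} {N : nat}
    (c c' : R -> 'M[R[i]]_N) : Prop :=
  forall i j, complex_C1_derivative (fun t => c t i j) (fun t => c' t i j).

Lemma matrix_C1_derivativeM {R : realType} {N : nat}
    (c c' d d' : R -> 'M[R[i]]_N) :
  matrix_C1_derivative c c' -> matrix_C1_derivative d d' ->
  matrix_C1_derivative (fun t => c t *m d t)
                       (fun t => c' t *m d t + c t *m d' t).
Proof.
move=> Dc Dd i j; under eq_fun do rewrite mxE.
under [X in complex_C1_derivative _ X]eq_fun do rewrite !mxE -big_split/=.
apply: complex_C1_derivative_sum => k; exact: complex_C1_derivativeM.
Qed.

Lemma matrix_C1_derivative_cst {R : realType} {N : nat} (A : 'M[R[i]]_N) :
  matrix_C1_derivative (fun=> A) (fun=> 0).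
Proof.
move=> i j; under [X in complex_C1_derivative _ X]eq_fun do rewrite mxE.
exact: complex_C1_derivative_cst.
Qed.

Lemma C1_curve_of_derivative {R : realType} {N : nat} (c c' : R -> 'M[R[i]]_N) :
  matrix_C1_derivative c c' -> C1_curve c.
Proof.
have C1_of (f f' : R -> R) : C1_derivative f f' -> C1_function f.
  move=> [df cf]; split=> [t|]; first by have [] := df t.
  suff -> : derive1 f = f' by [].
  by apply/funext => t; rewrite derive1E; have [_ ->] := df t.
by move=> dc i j; have [Dr Di] := dc i j; split; [exact: C1_of Dr|exact: C1_of Di].
Qed.

Lemma velocity_of_derivative {R : realType} {N : nat} (c c' : R -> 'M[R[i]]_N)
    (t : R) : matrix_C1_derivative c c' -> velocity c t = c' t.
Proof.
move=> dc; apply/matrixP => i j; have [[Dr _] [Di _]] := dc i j.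
have [_ Er] := Dr t; have [_ Ei] := Di t.
by rewrite mxE !derive1E Er Ei; case: (c' t i j).
Qed.

(** * Differentials of the potentials along a curve *)

(** The derivative of [|z|^2] in the direction [w]. *)
Definition sq_modulus_rate {R : realType} (z w : R[i]) : R :=
  2 * (complex.Re z * complex.Re w + complex.Im z * complex.Im w).

(** This and the next two definitions are the differentials at [G], in the
    direction [V], of the three potentials. *)
Definition row_sum_rate {R : realType} {N : nat} (alpha beta : R) (x : 'I_N)
    (G V : 'M[R[i]]_N) : R :=
  \sum_(j < N | j != x)
     expR (alpha * modulus (G x j) ^+ 2) * sq_modulus_rate (G x j) (V x j)
  + beta * (expR (modulus (G x x) ^+ 2) * sq_modulus_rate (G x x) (V x x)).

Definition chain_rate {R : realType} {N : nat} (alpha beta : R)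
    (G V : 'M[R[i]]_N) : R :=
  \sum_(x < N)
     2 * (row_sum_potential alpha beta x G
          - row_sum_potential alpha beta (ordS x) G)
       * (row_sum_rate alpha beta x G V
          - row_sum_rate alpha beta (ordS x) G V).

Definition diagonal_rate {R : realType} {N : nat} (delta : R)
    (G V : 'M[R[i]]_N) : R :=
  \sum_(j < N)
     sq_modulus_rate (G j j) (V j j) * expR (delta * modulus (G j j) ^+ 2).

Lemma sqr_modulusE {R : realType} (z : R[i]) :
  modulus z ^+ 2 = complex.Re z ^+ 2 + complex.Im z ^+ 2.
Proof.
by rewrite /modulus normc_def /= sqr_sqrtr// addr_ge0// sqr_ge0.
Qed.

Lemma is_derive_bigsum {R : realType} {n : nat} (P : pred 'I_n)
    (f : 'I_n -> R -> R) (df : 'I_n -> R) (t : R) :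
  (forall i, is_derive t (1 : R) (f i) (df i)) ->
  is_derive t (1 : R) (fun s => \sum_(i | P i) f i s) (\sum_(i | P i) df i).
Proof.
move=> Df; rewrite big_mkcond/=.
have -> : (fun s => \sum_(i | P i) f i s) =
    \sum_i (fun s => if P i then f i s else 0).
  by apply/funext => s; rewrite big_mkcond/= fct_sumE.
apply: is_derive_sum => i; case: (P i); first exact: Df.
exact: is_derive_cst.
Qed.

Section PotentialDerivatives.
Context {R : realType} {N : nat} (c : R -> 'M[R[i]]_N).
Hypothesis c_C1 : C1_curve c.
Local Notation V := (velocity c 0).

Lemma is_derive_sq_modulus i j :
  is_derive (0 : R) (1 : R) (fun t => modulus (c t i j) ^+ 2)
    (sq_modulus_rate (c 0 i j) (V i j)).
Proof.
have [[/(_ 0) Dr _] [/(_ 0) Di _]] := c_C1 i j.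
rewrite (_ : (fun t => _) = (fun t => complex.Re (c t i j) * complex.Re (c t i j)
   + complex.Im (c t i j) * complex.Im (c t i j))); last first.
  by apply/funext => t; rewrite sqr_modulusE !expr2.
move/derivableP in Dr; move/derivableP in Di.
apply: is_derive_eq (is_deriveD (is_deriveM Dr Dr) (is_deriveM Di Di)) _.
by rewrite /sq_modulus_rate !mxE/= !derive1E /GRing.scale/=; ring.
Qed.

Lemma is_derive_exp_sq_modulus (a : R) i j :
  is_derive (0 : R) (1 : R) (fun t => expR (a * modulus (c t i j) ^+ 2))
    (a * (expR (a * modulus (c 0 i j) ^+ 2) * sq_modulus_rate (c 0 i j) (V i j))).
Proof.
have D := is_derive_sq_modulus i j.
apply: is_derive_eq (is_derive1_comp (is_derive_expR _) (is_deriveZ a D)) _.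
by rewrite /GRing.scale/=; ring.
Qed.

Lemma is_derive_row_sum (alpha beta : R) x : alpha != 0 ->
  is_derive (0 : R) (1 : R) (fun t => row_sum_potential alpha beta x (c t))
    (row_sum_rate alpha beta x (c 0) V).
Proof.
move=> a0; rewrite /row_sum_potential.
have Doff := is_derive_bigsum (fun j => j != x)
  (fun j => is_derive_exp_sq_modulus alpha x j).
have Ddiag := is_derive_exp_sq_modulus 1 x x.
under [X in is_derive _ _ X _]eq_fun do rewrite -[modulus (c _ x x) ^+ 2]mul1r.
apply: is_derive_eq (is_deriveD (is_deriveZ _ Doff) (is_deriveZ _ Ddiag)) _.
rewrite /row_sum_rate -mulr_sumr /GRing.scale/= !mul1r; field.
by [].
Qed.

Lemma is_derive_chain (alpha beta : R) : alpha != 0 ->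
  is_derive (0 : R) (1 : R) (fun t => chain_potential alpha beta (c t))
    (chain_rate alpha beta (c 0) V).
Proof.
move=> a0; apply: (is_derive_bigsum xpredT) => x.
have D := is_deriveB (is_derive_row_sum beta x a0)
  (is_derive_row_sum beta (ordS x) a0).
apply: is_derive_eq (is_deriveX 2 D) _.
by rewrite /GRing.scale/= expr1.
Qed.

Lemma is_derive_diagonal (K : nat) (delta : R) : delta != 0 ->
  is_derive (0 : R) (1 : R) (fun t => diagonal_potential K delta (c t))
    (diagonal_rate delta (c 0) V).
Proof.
move=> d0.
have D := is_derive_bigsum xpredT
  (fun j => is_derive_exp_sq_modulus delta j j).
apply: is_derive_eq (is_deriveB (is_deriveZ delta^-1 D) (is_derive_cst _ _ _)) _.
rewrite subr0 /GRing.scale/= -mulr_sumr mulrA mulVf// mul1r.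
by apply: eq_bigr => j _; rewrite mulrC.
Qed.

Lemma is_derive_potential (K : nat) (alpha beta delta : R) :
  alpha != 0 -> delta != 0 ->
  is_derive (0 : R) (1 : R)
    (fun t => diagonal_potential K delta (c t) + chain_potential alpha beta (c t))
    (diagonal_rate delta (c 0) V + chain_rate alpha beta (c 0) V).
Proof.
by move=> a0 d0; apply: is_deriveD; [exact: is_derive_diagonal|exact: is_derive_chain].
Qed.

End PotentialDerivatives.

(** * A curve of projections that moves two diagonal entries *)

(** [X] plays the role of the imaginary unit on the range of [P], and [a + 1] and
    [b] those of a cosine and a sine: the last hypothesis is
    [(a + 1) ^ 2 + b ^ 2 = 1]. *)
Lemma rotation_identity {C : comNzRingType} {N : nat} (P X : 'M[C]_N) (a b : C) :
  P *m P = P -> P *m X = X -> X *m P = X -> X *m X = - P ->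
  a + a + a * a + b * b = 0 ->
  (1%:M + (a *: P + b *: X)) *m (1%:M + (a *: P + - b *: X)) = 1%:M.
Proof.
move=> PP PX XP XX ab.
rewrite mulmxDl mul1mx mulmxDr mulmx1 mulmxDl !mulmxDr.
rewrite -!scalemxAl -!scalemxAr PP PX XP XX -addrA -[RHS]addr0; congr (_ + _).
transitivity ((a + a + a * a + b * b) *: P); last by rewrite ab scale0r.
by apply/matrixP => i j; rewrite !mxE; ring.
Qed.

Section Rotation.
Context {R : realType} {N : nat}.
Variables (p q : 'I_N) (z : R[i]).
Hypotheses (pq : p != q) (z_unit : z * Num.conj z = 1).

Let P : 'M[R[i]]_N := delta_mx p p + delta_mx q q.
Let X : 'M[R[i]]_N := z *: delta_mx p q - Num.conj z *: delta_mx q p.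

(** For [c = cos t] and [s = sin t] this is the exponential of [t X]: [X] is
    skew-Hermitian and [X ^ 2 = - P]. *)
Definition rotation (c s : R) : 'M[R[i]]_N :=
  1%:M + (real_complex R (c - 1) *: P + real_complex R s *: X).

Lemma rotation1 : rotation 1 0 = 1%:M.
Proof. by rewrite /rotation subrr !scale0r !addr0. Qed.

Lemma adjoint_rotation c s : adjoint (rotation c s) = rotation c (- s).
Proof.
have conjR (x : R) : Num.conj (real_complex R x) = real_complex R x.
  exact: conjc_real.
apply/matrixP => i j; rewrite !mxE !(rmorphD, rmorphM, rmorphN, rmorph_nat)/=.
rewrite conjCK !conjR [j == i]eq_sym !(andbC (j == _)).
by ring.
Qed.

Lemma rotationV c s : c ^+ 2 + s ^+ 2 = 1 ->
  rotation c s *m rotation c (- s) = 1%:M.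
Proof.
move=> cs; have qp : q != p by rewrite eq_sym.
have PP : P *m P = P.
  rewrite mulmxDl !mulmxDr !mul_delta_mx_cond !eqxx (negPf pq) (negPf qp).
  by rewrite !mulr1n !mulr0n addr0 add0r.
have PX : P *m X = X.
  rewrite mulmxDl !mulmxBr -!scalemxAr !mul_delta_mx_cond !eqxx.
  by rewrite (negPf pq) (negPf qp) !mulr1n !mulr0n !scaler0 !(subr0, sub0r).
have XP : X *m P = X.
  rewrite mulmxBl !mulmxDr -!scalemxAl !mul_delta_mx_cond !eqxx.
  by rewrite (negPf pq) (negPf qp) !mulr1n !mulr0n !(scaler0, addr0, add0r).
have XX : X *m X = - P.
  rewrite mulmxBl !mulmxBr -!scalemxAl -!scalemxAr !mul_delta_mx_cond !eqxx.
  rewrite (negPf pq) (negPf qp) !mulr1n !mulr0n !scaler0 !scalerA.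
  by rewrite (mulrC (Num.conj z)) z_unit !scale1r subr0 sub0r opprD.
rewrite /rotation rmorphN /=; apply: rotation_identity => //.
rewrite -!rmorphM -!rmorphD/= [X in real_complex R X](_ : _ = 0) ?rmorph0//.
by transitivity (c ^+ 2 + s ^+ 2 - 1); [ring|rewrite cs subrr].
Qed.

Definition rotation_orbit (G : 'M[R[i]]_N) (t : R) : 'M[R[i]]_N :=
  rotation (cos t) (sin t) *m G *m rotation (cos t) (- sin t).

(** At time 0 the rotation is the identity and its derivative is [X], so the
    product rule gives the commutator of [X] and [G]. *)
Lemma rotation_orbit_derivative (G : 'M[R[i]]_N) :
  exists2 c', matrix_C1_derivative (rotation_orbit G) c'
            & c' 0 = X *m G - G *m X.
Proof.
have rotation_derivative (f f' g g' : R -> R) :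
    C1_derivative f f' -> C1_derivative g g' ->
    matrix_C1_derivative (fun t => rotation (f t) (g t))
      (fun t => real_complex R (f' t) *: P + real_complex R (g' t) *: X).
  have real_C1 (h h' : R -> R) : C1_derivative h h' ->
      complex_C1_derivative (fun t => real_complex R (h t))
                            (fun t => real_complex R (h' t)).
    by move=> dh; split=> //; exact: C1_derivative_cst.
  move=> df dg i j; under eq_fun do rewrite !mxE.
  have D1 := complex_C1_derivativeM
    (real_C1 _ _ (C1_derivativeB df (C1_derivative_cst 1)))
    (complex_C1_derivative_cst (P i j)).
  have D2 := complex_C1_derivativeM (real_C1 _ _ dg)
    (complex_C1_derivative_cst (X i j)).
  have := complex_C1_derivativeD
    (complex_C1_derivative_cst ((1%:M : 'M[R[i]]_N) i j))
    (complex_C1_derivativeD D1 D2).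
  by congr complex_C1_derivative; apply/funext => t;
    rewrite ?mxE// !mulr0 !addr0 subr0 add0r.
have D1 := rotation_derivative _ _ _ _ C1_derivative_cos C1_derivative_sin.
have D2 := rotation_derivative _ _ _ _ C1_derivative_cos
  (C1_derivativeB (C1_derivative_cst 0) C1_derivative_sin).
have := matrix_C1_derivativeM
  (matrix_C1_derivativeM D1 (matrix_C1_derivative_cst G)) D2.
move=> dc; eexists.
  have -> : rotation_orbit G = fun t => rotation (cos t) (sin t) *m G *m
      rotation (cos t) (0 - sin t).
    by apply/funext => t; rewrite sub0r.
  exact: dc.
rewrite /= cos0 sin0 subr0 rotation1 sub0r oppr0 rmorph0 rmorphN rmorph1.
by rewrite !scale0r !add0r mulmx0 addr0 !mulmx1 mul1mx !scale1r scaleN1r mulmxN.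
Qed.

End Rotation.

Lemma projections_hermitian {R : realType} {F : scalar_field} {N K : nat}
    (G : 'M[R[i]]_N) (i j : 'I_N) :
  projections F K G -> G j i = Num.conj (G i j).
Proof. by move=> [_ _ Gadj _]; rewrite {1}Gadj !mxE. Qed.

Lemma unitary_conjugate_projections {R : realType} {F : scalar_field} {N K : nat}
    (G U : 'M[R[i]]_N) : projections F K G -> U \is a mxOver (scalars F) ->
  adjoint U \is a mxOver (scalars F) ->
  adjoint U *m U = 1%:M -> projections F K (U *m G *m adjoint U).
Proof.
have adjointM (A B : 'M[R[i]]_N) : adjoint (A *m B) = adjoint B *m adjoint A.
  by rewrite /adjoint trmx_mul map_mxM.
have adjointK (A : 'M[R[i]]_N) : adjoint (adjoint A) = A.
  by apply/matrixP => i j; rewrite !mxE conjCK.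
have mulF (A B : 'M[R[i]]_N) : A \is a mxOver (scalars F) ->
    B \is a mxOver (scalars F) -> A *m B \is a mxOver (scalars F).
  by case: F => [|_ _]; [exact: mxOverM|exact/mxOverP].
move=> [GF GG Gadj trG] UF U'F UU; split.
- by apply: (mulF _ _ (mulF _ _ UF GF) U'F).
- by rewrite !mulmxA -(mulmxA _ _ U) UU mulmx1 -(mulmxA U G G) -GG.
- by rewrite !adjointM adjointK -Gadj mulmxA.
- by rewrite mxtrace_mulC mulmxA UU mul1mx.
Qed.

(** With [z] the phase of [G p q], the commutator of [X] and [G] has the diagonal
    entries [z * G q p + z^* * G p q = 2 |G p q|] at [p], the opposite at [q], and
    0 elsewhere.  The phase is a real number when [G] is real, so the curve
    stays within the real matrices in that case. *)
Lemma diagonal_moving_curve {R : realType} {F : scalar_field} {N K : nat}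
    (G : 'M[R[i]]_N) (p q : 'I_N) :
  projections F K G -> p != q -> G p q != 0 ->
  exists2 c, curve_through (projections F K) G c &
    forall j, complex.Re (velocity c 0 j j) =
              ((j == p)%:R - (j == q)%:R) * (2 * modulus (G p q)).
Proof.
move=> GM pq Gpq0; set z := G p q / `|G p q|.
have nG0 : `|G p q| != 0 by rewrite normr_eq0.
have zG : Num.conj z * G p q = `|G p q|.
  rewrite rmorphM fmorphV/= (conj_Creal (normr_real _)) mulrAC [X in X * _]mulrC.
  by rewrite -normCK expr2 mulfK.
have Gqp := projections_hermitian p q GM.
have zG' : z * G q p = `|G p q|.
  by rewrite Gqp /z mulrAC -normCK expr2 mulfK.
have z_unit : z * Num.conj z = 1.
  by rewrite -normCK normrM normfV normr_id divff// expr1n.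
have [c' Dc c'0] := rotation_orbit_derivative p q z G.
have unitary c s : c ^+ 2 + s ^+ 2 = 1 -> 
  adjoint (rotation p q z c s) *m rotation p q z c s = 1%:M.
  move=> cs; rewrite adjoint_rotation -[s in X in _ *m X]opprK.
  by apply: rotationV => //; rewrite sqrrN.
exists (rotation_orbit p q z G).
  split; first exact: C1_curve_of_derivative Dc.
    move=> t; rewrite /rotation_orbit -adjoint_rotation.
    have rotF c s : rotation p q z c s \is a mxOver (scalars F).
      case: (F) GM => -[GF _ _ _]; apply/mxOverP => i j //=.
      have zR : z \is Num.real.
        by rewrite rpredM// ?realV ?normr_real//; have /mxOverP := GF; apply.
      have RR (x : R) : real_complex R x \is Num.real by rewrite complex_real.
      rewrite !mxE (conj_Creal zR).
      rewrite rpredD ?rpred_nat// rpredD// rpredM ?RR// 1?rpredD ?rpred_nat//.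
        by rewrite rpredM ?rpred_nat.
      by rewrite rpredN rpredM ?rpred_nat.
    apply: unitary_conjugate_projections => //; rewrite ?adjoint_rotation//.
    by rewrite -adjoint_rotation unitary// cos2Dsin2.
  by rewrite /rotation_orbit cos0 sin0 oppr0 rotation1 mul1mx mulmx1.
move=> j; rewrite (velocity_of_derivative _ Dc) c'0.
have mulEl (a b : 'I_N) : (delta_mx a b *m G) j j = (j == a)%:R * G b a.
  rewrite mxE (bigD1 b)//= big1 => [|l lb]; rewrite mxE.
    by rewrite addr0 eqxx andbT; case: eqVneq => [->//|_]; rewrite !mul0r.
  by rewrite (negPf lb) andbF mul0r.
have mulEr (a b : 'I_N) : (G *m delta_mx a b) j j = (j == b)%:R * G b a.
  rewrite mxE (bigD1 a)//= big1 => [|l la]; rewrite mxE.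
    by rewrite addr0 eqxx mulrC; case: eqVneq => [->//|_]; rewrite !mul0r.
  by rewrite (negPf la) mulr0.
have -> : ((z *: delta_mx p q - Num.conj z *: delta_mx q p) *m G -
    G *m (z *: delta_mx p q - Num.conj z *: delta_mx q p)) j j =
    ((j == p)%:R - (j == q)%:R) * (Num.conj z * G p q + z * G q p).
  rewrite mulmxBl mulmxBr -!scalemxAl -!scalemxAr.
  have entry (a b : R[i]) (A B A' B' : 'M[R[i]]_N) :
      (a *: A - b *: B - (a *: A' - b *: B')) j j =
      a * A j j - b * B j j - (a * A' j j - b * B' j j) by rewrite !mxE.
  by rewrite entry !mulEl !mulEr; ring.
rewrite zG zG' /modulus normc_def /=.
by case: (j == p); case: (j == q); rewrite /= ; ring.
Qed.

(** * Functions on a cycle *)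

(** The increments add up to 0 around the cycle, so if they are all equal then
    they are all 0. *)
Lemma constant_of_cyclic_increments {R : numDomainType} {N : nat} (u : 'I_N -> R) :
  (forall x y, u x - u (ordS x) = u y - u (ordS y)) ->
  forall x y, u x = u y.
Proof.
move=> incr x0 y0.
have step x : u (ordS x) = u x.
  have : \sum_y (u y - u (ordS y)) = 0.
    rewrite sumrB [X in X - _](reindex_inj (@ordS_inj N)) /=.
    exact: subrr.
  under eq_bigr do rewrite (incr _ x).
  rewrite sumr_const card_ord => /eqP; rewrite mulrn_eq0.
  case: N x {incr x0 y0} u => [[]//|N] x u /=.
  by rewrite subr_eq0 eq_sym => /eqP.
case: N u {incr} step x0 y0 => [|N] u step; first by case.
have to0 k (kN : (k < N.+1)%N) : u (Ordinal kN) = u ord0.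
  elim: k kN => [|k IHk] kN; first by congr u; exact: val_inj.
  rewrite -(IHk (ltnW kN)) -[RHS]step; congr u; apply: val_inj => /=.
  by rewrite modn_small.
by move=> [x xN] [y yN]; rewrite (to0 x) (to0 y).
Qed.

(** * Moduli of the entries of a projection *)

Lemma norm_modulus {R : realType} (z : R[i]) :
  `|z| = real_complex R (modulus z).
Proof. by rewrite /modulus normc_def. Qed.

Lemma modulus_ge0 {R : realType} (z : R[i]) : 0 <= modulus z.
Proof. by rewrite /modulus normc_def /= sqrtr_ge0. Qed.

Lemma modulus_gt0 {R : realType} (z : R[i]) : z != 0 -> 0 < modulus z.
Proof.
move=> z0; rewrite lt_def modulus_ge0 andbT; apply: contraNneq z0 => m0.
by rewrite -normr_eq0 norm_modulus m0.
Qed.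

Section Projections.
Context {R : realType} {F : scalar_field} {N K : nat} {G : 'M[R[i]]_N}.
Hypothesis GM : projections F K G.

Lemma projections_modulusC i j : modulus (G i j) = modulus (G j i).
Proof. by rewrite (projections_hermitian i j GM) /modulus norm_conjC. Qed.

(** This is the diagonal of [G = G *m adjoint G]. *)
Lemma projections_diag j :
  G j j = real_complex R (\sum_l modulus (G l j) ^+ 2).
Proof.
have [_ GG _ _] := GM; rewrite [in LHS]GG mxE rmorph_sum /=.
apply: eq_bigr => l _; rewrite sqr_modulusE add_Re2_Im2 normCK.
by rewrite (projections_hermitian l j GM) mulrC.
Qed.

Lemma projections_modulus_diag j :
  modulus (G j j) = \sum_l modulus (G l j) ^+ 2.
Proof.
rewrite [in LHS]projections_diag /modulus ger0_norm//.
by rewrite ler0c sumr_ge0// => l _; rewrite sqr_ge0.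
Qed.

Lemma sq_modulus_rate_diag j (w : R[i]) :
  sq_modulus_rate (G j j) w = 2 * modulus (G j j) * complex.Re w.
Proof.
by rewrite /sq_modulus_rate projections_modulus_diag projections_diag /=; ring.
Qed.

End Projections.

(** The trace is constant on the projections of a given rank. *)
Lemma trace_velocity {R : realType} {F : scalar_field} {N K : nat}
    (G : 'M[R[i]]_N) (c : R -> 'M[R[i]]_N) :
  curve_through (projections F K) G c ->
  \sum_j complex.Re (velocity c 0 j j) = 0.
Proof.
move=> [c_C1 cM _].
have D : is_derive (0 : R) (1 : R) (fun t => \sum_(j < N) complex.Re (c t j j))
    (\sum_j complex.Re (velocity c 0 j j)).
  apply: (is_derive_bigsum xpredT) => j; rewrite mxE /= derive1E.
  by apply/derivableP; have [[]] := c_C1 j j.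
have cst_tr : (fun t => \sum_(j < N) complex.Re (c t j j)) =
    cst (complex.Re (K%:R : R[i])).
  by apply/funext => t; have [_ _ _ <-] := cM t; rewrite /mxtrace raddf_sum.
have [_ <-] := D; rewrite cst_tr.
by have [_ ->] := is_derive_cst (complex.Re (K%:R : R[i])) (0 : R) (1 : R).
Qed.

(** * Equidistributed projections are critical *)

Lemma row_sum_potentialE {R : realType} {N : nat} (alpha beta : R) (x : 'I_N)
    (G : 'M[R[i]]_N) :
  row_sum_potential alpha beta x G =
  alpha^-1 * (\sum_j expR (alpha * modulus (G x j) ^+ 2)
              - expR (alpha * modulus (G x x) ^+ 2))
  + beta * expR (modulus (G x x) ^+ 2).
Proof.
by rewrite /row_sum_potential [in RHS](bigD1 x)//= [in RHS]addrC addrK.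
Qed.

Lemma equidistributed_diag {R : realType} {F : scalar_field} {N K : nat}
    {G : 'M[R[i]]_N} (p q : 'I_N) : projections F K G -> equidistributed G ->
  modulus (G p p) = modulus (G q q).
Proof.
move=> GM eqG; rewrite !(projections_modulus_diag GM); have [s sE] := eqG p q.
rewrite [RHS](reindex_inj (@perm_inj _ s)) /=.
by apply: eq_bigr => l _; rewrite sE.
Qed.

Lemma equidistributed_row_sum {R : realType} {F : scalar_field} {N K : nat}
    {G : 'M[R[i]]_N} (alpha beta : R) (p q : 'I_N) :
  projections F K G -> equidistributed G ->
  row_sum_potential alpha beta p G = row_sum_potential alpha beta q G.
Proof.
move=> GM eqG; rewrite !row_sum_potentialE (equidistributed_diag p q GM eqG).
congr (_ * (_ - _) + _); have [s sE] := eqG p q.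
rewrite [RHS](reindex_inj (@perm_inj _ s)) /=.
apply: eq_bigr => l _; rewrite (projections_modulusC GM p) sE.
by rewrite (projections_modulusC GM q).
Qed.

Lemma diagonal_rate_const_diag {R : realType} {F : scalar_field} {N K : nat}
    {G : 'M[R[i]]_N} (delta : R) (c : R -> 'M[R[i]]_N) :
  projections F K G -> curve_through (projections F K) G c ->
  (forall p q, modulus (G p p) = modulus (G q q)) ->
  diagonal_rate delta G (velocity c 0) = 0.
Proof.
move=> GM Gc diagG; case: N K G c GM Gc diagG => [|N] K G c GM Gc diagG.
  by rewrite /diagonal_rate big_ord0.
set a := modulus (G ord0 ord0).
transitivity (2 * a * expR (delta * a ^+ 2) *
    \sum_j complex.Re (velocity c 0 j j)).
  rewrite mulr_sumr; apply: eq_bigr => j _.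
  by rewrite (sq_modulus_rate_diag GM) (diagG j ord0) -/a; ring.
by rewrite (trace_velocity Gc) mulr0.
Qed.

Lemma equidistributed_critical {R : realType} {F : scalar_field} {N K : nat}
    {G : 'M[R[i]]_N} (alpha beta delta : R) :
  projections F K G -> equidistributed G -> alpha != 0 -> delta != 0 ->
  is_riemannian_gradient (projections F K)
    (fun X => diagonal_potential K delta X + chain_potential alpha beta X) G 0.
Proof.
move=> GM eqG a0 d0; split.
  have D0 := matrix_C1_derivative_cst G.
  exists (fun=> G); last by rewrite (velocity_of_derivative _ D0).
  by split=> //; exact: C1_curve_of_derivative D0.
move=> c Gc; have [c_C1 cM c0] := Gc.
apply: is_derive_eq (is_derive_potential c_C1 K beta a0 d0) _.
rewrite c0 /trace_metric mul0mx mxtrace0 /=.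
rewrite (diagonal_rate_const_diag _ GM Gc); last first.
  by move=> p q; exact: equidistributed_diag GM eqG.
rewrite add0r /chain_rate big1// => x _.
by rewrite (equidistributed_row_sum alpha beta x (ordS x) GM eqG) subrr mulr0 mul0r.
Qed.

(** * Critical projections are equidistributed *)

Lemma critical_rate {R : realType} {F : scalar_field} {N K : nat}
    {G : 'M[R[i]]_N} (alpha beta delta : R) (c : R -> 'M[R[i]]_N) :
  alpha != 0 -> delta != 0 ->
  is_riemannian_gradient (projections F K)
    (fun X => diagonal_potential K delta X + chain_potential alpha beta X) G 0 ->
  curve_through (projections F K) G c ->
  diagonal_rate delta G (velocity c 0)
  + chain_rate alpha beta G (velocity c 0) = 0.
Proof.
move=> a0 d0 [_ crit] Gc; have [c_C1 _ c0] := Gc.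
have [_ Dcrit] := crit c Gc.
have [_] := is_derive_potential c_C1 K beta a0 d0.
by rewrite Dcrit c0 /trace_metric mul0mx mxtrace0 => <-.
Qed.

Section Converse.
Context {R : realType} {F : scalar_field} {N K : nat} {G : 'M[R[i]]_N}.
Hypotheses (GM : projections F K G) (G_neq0 : forall a b, G a b != 0).

(** Only [delta] varies here: the chain potential contributes a constant, that
    is, a term of exponent 0.  As the exponents [|G_jj|^2] are positive, it
    cannot cancel the others. *)
Lemma critical_diag (alpha beta : R) (T : set R) :
  open_interval T -> alpha != 0 -> (forall delta, T delta -> delta != 0) ->
  (forall delta, T delta ->
     is_riemannian_gradient (projections F K)
       (fun X => diagonal_potential K delta X + chain_potential alpha beta X)
       G 0) ->
  forall p q, modulus (G p p) = modulus (G q q).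
Proof.
move=> oT a0 T0 crit p q; have [->//|pq] := eqVneq p q.
have [c Gc cV] := diagonal_moving_curve GM pq (G_neq0 p q).
pose a j := modulus (G j j) ^+ 2.
pose r j := sq_modulus_rate (G j j) (velocity c 0 j j).
pose C := chain_rate alpha beta G (velocity c 0).
(* The extra index carries the constant term [C]. *)
pose m (o : 'I_N + 'I_1) := if o is inl j then r j else C.
pose e (o : 'I_N + 'I_1) := if o is inl j then a j else 0.
have m_sum delta : T delta -> \sum_o m o * expR (delta * e o) = 0.
  move=> Td; have := critical_rate a0 (T0 _ Td) (crit _ Td) Gc.
  by rewrite big_sumType big_ord1 /= mulr0 expR0 mulr1.
have a_gt0 j : 0 < a j by rewrite exprn_gt0// modulus_gt0.
have rE j : r j = 2 * modulus (G j j) *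
    (((j == p)%:R - (j == q)%:R) * (2 * modulus (G p q))).
  by rewrite /r (sq_modulus_rate_diag GM) cV.
have [apq|apq] := eqVneq (a q) (a p).
  by apply/eqP; rewrite -(@eqrXn2 _ 2)// ?modulus_ge0// -/(a p) -apq.
(* If [a q != a p], then [r p] is the only weight of exponent [a p]. *)
have := exp_sum_eq0 oT m_sum (a p); rewrite big_sumType /=.
rewrite [X in _ + X]big_pred0 => [|i]; last by rewrite eq_sym gt_eqF.
rewrite addr0 (bigD1 p)//= big1 => [|j /andP[/eqP aj jp]]; last first.
  rewrite rE (negPf jp) (_ : j == q = false) ?subrr ?mul0r ?mulr0//.
  by apply: contra_neqF apq => /eqP <-.
move/eqP; rewrite addr0 rE eqxx (negPf pq) subr0 mul1r gt_eqF//.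
by rewrite !mulr_gt0// modulus_gt0.
Qed.

Hypothesis diagG : forall p q, modulus (G p p) = modulus (G q q).

Lemma row_sum_potential_diff (alpha beta : R) x y :
  row_sum_potential alpha beta x G - row_sum_potential alpha beta y G =
  alpha^-1 * (\sum_j expR (alpha * modulus (G x j) ^+ 2)
              - \sum_j expR (alpha * modulus (G y j) ^+ 2)).
Proof. by rewrite !row_sum_potentialE (diagG y x); ring. Qed.

(** Comparing two values of [beta] isolates the slope of an affine function of
    [beta].  Summation by parts on the cycle turns this slope into a combination
    of the second differences of the row sums, and the test curves show that
    these second differences are all equal. *)
Lemma critical_row_sum (alpha delta beta1 beta2 : R) :
  alpha != 0 -> delta != 0 -> beta1 != beta2 ->
  (forall beta, beta = beta1 \/ beta = beta2 ->
     is_riemannian_gradient (projections F K)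
       (fun X => diagonal_potential K delta X + chain_potential alpha beta X)
       G 0) ->
  forall x y, \sum_j expR (alpha * modulus (G x j) ^+ 2) =
              \sum_j expR (alpha * modulus (G y j) ^+ 2).
Proof.
move=> a0 d0 b12 crit.
pose Rs x := \sum_j expR (alpha * modulus (G x j) ^+ 2).
pose r x := Rs x - Rs (ordS x).
have r_incr x y : x != y -> r (ordS x) - r x = r (ordS y) - r y.
  move=> xy; set p := ordS x; set q := ordS y.
  have pq : p != q by rewrite (inj_eq (@ordS_inj N)).
  have [c Gc cV] := diagonal_moving_curve GM pq (G_neq0 p q).
  pose V := velocity c 0; pose v z := sq_modulus_rate (G z z) (V z z).
  pose a := modulus (G p p).
  have chain0 beta : beta = beta1 \/ beta = beta2 ->
      chain_rate alpha beta G V = 0.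
    move=> /crit crit_beta; have := critical_rate a0 d0 crit_beta Gc.
    by rewrite (diagonal_rate_const_diag _ GM Gc diagG) add0r.
  have chain_affine beta : chain_rate alpha beta G V =
      chain_rate alpha 0 G V +
      beta * (2 * alpha^-1 * expR (a ^+ 2)) * \sum_z r z * (v z - v (ordS z)).
    rewrite /chain_rate mulr_sumr -big_split/=; apply: eq_bigr => z _.
    rewrite !row_sum_potential_diff /row_sum_rate.
    by rewrite (diagG z p) (diagG (ordS z) p) -/a /r /Rs /v; ring.
  have : \sum_z r z * (v z - v (ordS z)) = 0.
    have : (beta1 - beta2) * (2 * alpha^-1 * expR (a ^+ 2)) *
        \sum_z r z * (v z - v (ordS z)) = 0.
      transitivity (chain_rate alpha beta1 G V - chain_rate alpha beta2 G V).
        by rewrite (chain_affine beta1) (chain_affine beta2); ring.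
      by rewrite (chain0 beta1) ?(chain0 beta2) ?subrr; auto.
    move/eqP; rewrite !mulf_eq0 subr_eq0 (negPf b12) invr_eq0 (negPf a0).
    by rewrite (gt_eqF (expR_gt0 _)) pnatr_eq0 /= => /eqP.
  under eq_bigr do rewrite mulrBr; rewrite sumrB.
  rewrite [X in X - _](reindex_inj (@ordS_inj N)) /= -sumrB.
  under eq_bigr do rewrite -mulrBl.
  have vE z : v (ordS z) =
      ((z == x)%:R - (z == y)%:R) * (4 * a * modulus (G p q)).
    rewrite /v (sq_modulus_rate_diag GM) cV (diagG _ p) -/a.
    by rewrite !(inj_eq (@ordS_inj N)); ring.
  under eq_bigr do rewrite vE mulrA; rewrite -mulr_suml => /eqP.
  rewrite mulf_eq0 orbC gt_eqF/=; last by rewrite !mulr_gt0// modulus_gt0.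
  under eq_bigr do rewrite mulrBr; rewrite sumrB.
  have pick (f : 'I_N -> R) z0 : \sum_z f z * (z == z0)%:R = f z0.
    rewrite (bigD1 z0)//= eqxx mulr1 big1 ?addr0// => z /negPf ->.
    by rewrite mulr0.
  by rewrite !pick subr_eq0 => /eqP.
have r_const : forall x y, r x = r y.
  apply: constant_of_cyclic_increments => x y.
  have [->//|xy] := eqVneq x y.
  by rewrite -[LHS]opprB -[RHS]opprB (r_incr _ _ xy).
exact: (@constant_of_cyclic_increments _ _ Rs).
Qed.

End Converse.

Unset Implicit Arguments.

Theorem theorem4p31 (R : realType) (F : scalar_field) (N K : nat)
    (K_ge1 : (1 <= K)%N) (K_leN : (K <= N)%N)
    (G : 'M[R[i]]_N) (GM : projections F K G)
    (G_neq0 : forall a b : 'I_N, G a b != 0)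
    (I J T : set R)
    (I_itv : open_interval I) (I_gt0 : I `<=` [set x : R | 0 < x])
    (J_itv : open_interval J) (J_gt0 : J `<=` [set x : R | 0 < x])
    (T_itv : open_interval T) (T_gt0 : T `<=` [set x : R | 0 < x]) :
  equidistributed G <->
  (forall alpha beta delta : R, I alpha -> J beta -> T delta ->
     is_riemannian_gradient (projections F K)
       (fun X => diagonal_potential K delta X
                 + chain_potential alpha beta X)
       G 0).
Proof.
have I0 s : I s -> s != 0 by move/I_gt0/lt0r_neq0.
have T0 s : T s -> s != 0 by move/T_gt0/lt0r_neq0.
split=> [eqG alpha beta delta Ia _ Td|crit p q].
  exact: equidistributed_critical GM eqG (I0 _ Ia) (T0 _ Td).
have [_ _ [alpha0 Ialpha0]] := I_itv.
have [_ _ [delta0 Tdelta0]] := T_itv.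
have [beta [h [h0 Jbeta]]] := open_interval_step J_itv 1.
have diagG : forall x y, modulus (G x x) = modulus (G y y).
  apply: (critical_diag GM G_neq0 T_itv (I0 _ Ialpha0) T0) => delta Tdelta.
  by apply: crit Ialpha0 (Jbeta 0%N isT) Tdelta.
have beta_neq : beta + 0%:R * h != beta + 1%:R * h.
  by rewrite mul0r mul1r addr0 -subr_eq0 opprD addNKr oppr_eq0 lt0r_neq0.
have row_sums alpha : I alpha -> forall x y,
    \sum_j expR (alpha * modulus (G x j) ^+ 2) =
    \sum_j expR (alpha * modulus (G y j) ^+ 2).
  move=> Ia; apply: (critical_row_sum GM G_neq0 diagG (I0 _ Ia) (T0 _ Tdelta0)
    beta_neq) => b [] ->; apply: crit => //; exact: Jbeta.
have [s sE] := perm_of_exp_sum_eq I_itv (fun alpha Ia => row_sums alpha Ia p q).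
exists s => j; apply/eqP; rewrite -(@eqrXn2 _ 2)// ?modulus_ge0//.
by rewrite !(projections_modulusC GM _ p, projections_modulusC GM _ q) sE.
Qed.
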